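(* Let $f:\mathbb R\to\mathbb R$ be locally of bounded variation. Then for every bounded open interval $E\subseteq\mathbb R$, $$\mathrm{pV}(f,E)=|\mu_f|(E)+\sum_{x\in E}\rho_f(x).$$
   Context: For a real-valued function $f$ and an interval $I$, the pointwise variation of $f$ on $I$ is $$\mathrm{pV}(f,I):=\sup\Big\{\sum_{0\le i<n}|f(t_{i+1})-f(t_i)|:\ t_i\in I,\ t_0<t_1<\dots<t_n\Big\}.$$ A function $f:\mathbb R\to\mathbb R$ is locally of bounded variation if $\mathrm{pV}(f,I)<+\infty$ for every bounded interval $I$. Then the one-sided limits $f(x^-)$ (left) and $f(x^+)$ (right) exist at every $x\in\mathbb R$, and $\mu_f$ denotes the associated signed measure, finite on the Borel subsets of any bounded interval, determined by: for $c<d$, $$\mu_f((c,d))=f(d^-)-f(c^+),\quad \mu_f([c,d])=f(d^+)-f(c^-),\quad \mu_f([c,d))=f(d^-)-f(c^-),\quad \mu_f((c,d])=f(d^+)-f(c^+),$$ and $\mu_f(\{c\})=f(c^+)-f(c^-)$. Its total variation measure is $$|\mu_f|(E)=\sup\Big\{\sum_{k=1}^m|\mu_f(A_k)|:\ A_1,\dots,A_m\subseteq E\text{ disjoint Borel sets}\Big\}.$$ For $x\in\mathbb R$, $$\rho_f(x):=|f(x^+)-f(x)|+|f(x)-f(x^-)|-|f(x^+)-f(x^-)|\ (\ge 0).$$ The sum over $x\in E$ is the (unordered) sum of nonnegative terms, i.e. the supremum of its finite partial sums. *)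

(* Defs.v *)
From HB Require Import structures.
From mathcomp Require Import all_boot all_order all_algebra.
From mathcomp Require Import all_classical all_reals all_analysis.

Set Implicit Arguments.
Unset Strict Implicit.
Unset Printing Implicit Defensive.

Import Order.TTheory GRing.Theory Num.Theory.
Import numFieldNormedType.Exports.

Local Open Scope classical_set_scope.
Local Open Scope ring_scope.

(* Only the values [t 0], ..., [t n] of the sequence [t] matter. *)
Definition pV (R : realType) (f : R -> R) (I : set R) : \bar R :=
  ereal_sup [set s : \bar R | exists (n : nat) (t : nat -> R),
    [/\ forall i, (i <= n)%N -> I (t i),
        forall i, (i < n)%N -> t i < t i.+1
      & s = (\sum_(0 <= i < n) `|f (t i.+1) - f (t i)|)%:E]].

Definition bounded_interval (R : realType) (I : set R) : Prop :=
  is_interval I /\ bounded_set I.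

Definition locally_bounded_variation (R : realType) (f : R -> R) : Prop :=
  forall I : set R, bounded_interval I -> (pV f I < +oo)%E.

(* [lim] is total; these are genuine limits when [f] is locally of bounded
   variation. *)
Definition left_lim (R : realType) (f : R -> R) (x : R) : R :=
  lim (f y @[y --> x^'-]).

Definition right_lim (R : realType) (f : R -> R) (x : R) : R :=
  lim (f y @[y --> x^'+]).

(* [mu] need not be a charge on the whole line; the two conditions say that
   its restriction to each bounded interval [I], as the set function
   [A |-> mu (A `&` I)], is one. *)
Definition locally_finite_signed_measure (R : realType)
    (mu : set (measurableTypeR R) -> \bar R) : Prop :=
  forall I : set R, bounded_interval I ->
    fin_num_fun (fun A : set (measurableTypeR R) => mu (A `&` I)) /\
    semi_sigma_additive (fun A : set (measurableTypeR R) => mu (A `&` I)).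

Definition is_measure_of (R : realType) (f : R -> R)
    (mu : set (measurableTypeR R) -> \bar R) : Prop :=
  [/\ locally_finite_signed_measure mu,
      forall c d : R, c < d ->
        [/\ mu `]c, d[%classic = (left_lim f d - right_lim f c)%:E,
            mu `[c, d]%classic = (right_lim f d - left_lim f c)%:E,
            mu `[c, d[%classic = (left_lim f d - left_lim f c)%:E
          & mu `]c, d]%classic = (right_lim f d - right_lim f c)%:E]
    & forall c : R, mu [set c] = (right_lim f c - left_lim f c)%:E].

(* The signed measure [mu_f]: [is_measure_of f] determines its values on the
   bounded Borel sets, which are the only ones that are meaningful.  The
   default value [fun=> 0] is returned only if no such measure exists, which
   does not happen when [f] is locally of bounded variation. *)
Definition signed_measure_of (R : realType) (f : R -> R) :
    set (measurableTypeR R) -> \bar R :=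
  xget (fun=> 0%E) [set mu | is_measure_of f mu].

Definition total_variation_measure (R : realType)
    (mu : set (measurableTypeR R) -> \bar R) (E : set (measurableTypeR R)) :
    \bar R :=
  ereal_sup [set s : \bar R |
    exists (m : nat) (A : 'I_m -> set (measurableTypeR R)),
      [/\ forall k, measurable (A k),
          forall k, A k `<=` E,
          trivIset [set: 'I_m] A
        & s = (\sum_(k < m) `|mu (A k)|)%E]].

Definition rho (R : realType) (f : R -> R) (x : R) : R :=
  `|right_lim f x - f x| + `|f x - left_lim f x|
  - `|right_lim f x - left_lim f x|.

(* Main.v *)
Require Import Defs.
From HB Require Import structures.
From mathcomp Require Import all_boot all_order all_algebra.
From mathcomp Require Import all_classical all_reals all_analysis.
From mathcomp Require Import lra.

Set Implicit Arguments.
Unset Strict Implicit.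
Unset Printing Implicit Defensive.

Import Order.TTheory GRing.Theory Num.Theory.
Import numFieldNormedType.Exports.

Local Open Scope classical_set_scope.
Local Open Scope ring_scope.

(** Write [f = g - h] with [g], [h] nondecreasing and [g + h] increasing by
exactly the variation of [f] on every segment. Then [mu_f] is the difference of
the Lebesgue-Stieltjes measures [G], [H] of the right-continuous versions of [g]
and [h]; as [mu_f] is chosen by its values on intervals, this needs uniqueness,
which is Dynkin's theorem.

[pV <= |mu_f| + sum rho]: given [t_0 < ... < t_n], pass from [f (t_i)] to
[f (t_{i+1})] through [f (t_i^+)] and [f (t_{i+1}^-)]; the sets
[`]t_i, t_{i+1}[] and [{t_i}] compete in the supremum defining [|mu_f|], and
[rho] completes [|mu_f {t_i}|] into the sum of the two one-sided jumps.

[|mu_f| + sum rho <= pV]: the positive measure [nu = G + H] satisfies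
[|mu_f| <= nu], and even [|mu_f {x}| + rho x <= nu {x}] at each point, so that
[|mu_f A|] plus the sum of [rho] over finitely many points of [A] is at most
[nu A]. Finally [nu `]a, b[ = (g + h) (b^-) - (g + h) (a^+)] is the limit of
the variations of [f] on the segments [`[c, d]] exhausting [`]a, b[]. *)

(** * One-sided limits of a nondecreasing function *)

Section one_sided_limits.
Context {R : realType} (g : R -> R).
Hypothesis ndg : {homo g : x y / x <= y}.

Lemma nondecreasing_cvg_right_lim x : g y @[y --> x^'+] --> right_lim g x.
Proof.
apply: nondecreasing_at_right_is_cvgr.
  by apply: nearW => z y1 y2 _ _; exact: ndg.
apply: nearW => z; exists (g x) => _ [y yz <-]; move: yz.
rewrite /= in_itv/= => /andP[/ltW xy _]; exact: ndg.
Qed.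

Lemma nondecreasing_cvg_left_lim x : g y @[y --> x^'-] --> left_lim g x.
Proof.
apply: nondecreasing_at_left_is_cvgr.
  by apply: nearW => z y1 y2 _ _; exact: ndg.
apply: nearW => z; exists (g x) => _ [y yz <-]; move: yz.
rewrite /= in_itv/= => /andP[_ /ltW xy]; exact: ndg.
Qed.

Lemma right_lim_ge x : g x <= right_lim g x.
Proof.
apply: limr_ge; first exact: nondecreasing_cvg_right_lim.
by near=> y; apply: ndg; apply: ltW.
Unshelve. all: by end_near. Qed.

Lemma left_lim_le x : left_lim g x <= g x.
Proof.
apply: limr_le; first exact: nondecreasing_cvg_left_lim.
by near=> y; apply: ndg; apply: ltW.
Unshelve. all: by end_near. Qed.

Lemma right_lim_le x y : x < y -> right_lim g x <= g y.
Proof.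
move=> xy; apply: limr_le; first exact: nondecreasing_cvg_right_lim.
near=> z; apply: ndg; near: z; exact: nbhs_right_le.
Unshelve. all: by end_near. Qed.

Lemma left_lim_ge x y : x < y -> g x <= left_lim g y.
Proof.
move=> xy; apply: limr_ge; first exact: nondecreasing_cvg_left_lim.
near=> z; apply: ndg; near: z; exact: nbhs_left_ge.
Unshelve. all: by end_near. Qed.

Lemma nondecreasing_right_lim : nondecreasing (right_lim g).
Proof.
move=> x y; rewrite le_eqVlt => /predU1P[->//|xy].
exact: le_trans (right_lim_le xy) (right_lim_ge y).
Qed.

(** Choose [z > x] with [g z < right_lim g x + e]; every [y] in []x, z[] then satisfies
    [right_lim g x <= right_lim g y <= g z]. *)
Lemma right_continuous_right_lim x :
  right_lim g y @[y --> x^'+] --> right_lim g x.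
Proof.
apply/cvgrPdist_lt => e e0.
have /cvgrPdist_lt/(_ _ e0) gx := nondecreasing_cvg_right_lim (x := x).
near x^'+ => z.
have xz : x < z by [].
have : `|right_lim g x - g z| < e by near: z.
rewrite ltr_distlC => /andP[_ gze].
near=> y.
rewrite ltr_distlC (lt_le_trans _ (nondecreasing_right_lim (_ : x <= y)))/=.
- by apply: le_lt_trans gze; apply: right_lim_le.
- by rewrite ltrBlDr ltrDl.
- exact: ltW.
Unshelve. all: by end_near. Qed.

(** Left of [x], [right_lim g y] is squeezed between [g y] and [left_lim g x]. Hence the
    right-continuous version keeps the left limits of [g]. *)
Lemma cvg_right_lim_at_left x :
  right_lim g y @[y --> x^'-] --> left_lim g x.
Proof.
apply: (@squeeze_cvgr _ _ _ _ g (cst (left_lim g x))).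
- near=> y; have yx : y < x by [].
  rewrite right_lim_ge/=.
  apply: limr_le; first exact: nondecreasing_cvg_right_lim.
  near=> z; apply: left_lim_ge; near: z; exact: nbhs_right_lt.
- exact: nondecreasing_cvg_left_lim.
- exact: cvg_cst.
Unshelve. all: by end_near. Qed.

End one_sided_limits.

(** * Jordan decomposition on the line *)

Section jordan_decomposition.
Context {R : realType}.
Implicit Type f : R -> R.

Lemma pV_ge0 f (I : set R) x : I x -> (0 <= pV f I)%E.
Proof.
move=> Ix; apply: ereal_sup_ubound; exists 0%N, (cst x).
by split => //; rewrite big_nil.
Qed.

Lemma total_variation_le_pV f (I : set R) c d : c <= d ->
  `[c, d]%classic `<=` I -> (total_variation c d f <= pV f I)%E.
Proof.
move=> cd cdI; apply: ge_ereal_sup => _ [_ [s cds <-] <-].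
(* A partition list omits its initial point, so [c] is put back; with the default [d], [variation]
   unfolds to this very sum. *)
apply: ereal_sup_ubound; exists (size s), (nth d (c :: s)); split => //.
- move=> i si; apply: cdI; rewrite /= in_itv/=.
  by rewrite itv_partition_nth_ge ?itv_partition_nth_le.
- by move=> i si; case: cds => /(pathP d) + _; apply.
Qed.

Lemma bounded_interval_itv (i : interval R) c d :
  [set` i] `<=` `[c, d]%classic -> bounded_interval [set` i].
Proof.
move=> icd; split; first exact: interval_is_interval.
exists (Num.max `|c| `|d|); split => [|M]; first exact: num_real.
rewrite gt_max => /andP[cM dM] x /icd /=; rewrite in_itv/= => /andP[cx xd].
rewrite ler_norml (le_trans xd (le_trans (ler_norm _) (ltW dM))) andbT.
by rewrite (le_trans _ cx)// lerNl (le_trans _ (ltW cM))// -normrN ler_norm.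
Qed.

Lemma jordan_decomposition f : locally_bounded_variation f ->
  exists g h : R -> R, [/\ {homo g : x y / x <= y},
    {homo h : x y / x <= y}, f = g \- h &
    forall c d, c <= d ->
      (g d - g c + (h d - h c))%:E = total_variation c d f].
Proof.
move=> bvf.
have tvfin c d : c <= d -> total_variation c d f \is a fin_num.
  move=> cd; rewrite ge0_fin_numE ?total_variation_ge0//.
  apply: le_lt_trans (bvf `[c, d]%classic _).
    exact: total_variation_le_pV.
  exact: (@bounded_interval_itv _ c d).
(* Signed variation from the base point 0: the variation on a half-line may be infinite. *)
pose V x := if 0 <= x then fine (total_variation 0 x f)
  else - fine (total_variation x 0 f).
have VE c d : c <= d -> (V d - V c)%:E = total_variation c d f.
  move=> cd; rewrite -(fineK (tvfin _ _ cd)); congr _%:E.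
  rewrite /V; case: (leP 0 c) => c0.
    rewrite (le_trans c0 cd) (total_variationD f c0 cd) fineD ?tvfin//.
    by rewrite addrAC subrr add0r.
  case: (leP 0 d) => d0.
    by rewrite opprK addrC (total_variationD f (ltW c0) d0) fineD ?tvfin// ltW.
  rewrite (total_variationD f cd (ltW d0)) fineD ?tvfin// 1?ltW//.
  by rewrite opprK addrCA addNr addr0.
have le_V c d : c <= d -> `|f d - f c| <= V d - V c.
  by move=> cd; rewrite -lee_fin VE// total_variation_ge.
(* The two functions sum to [V], and both are nondecreasing because [V] dominates the increments of
   [f]. *)
exists (fun x => (V x + f x) / 2), (fun x => (V x - f x) / 2); split.
- by move=> x y /le_V; rewrite ler_norml => /andP[] *; lra.
- by move=> x y /le_V; rewrite ler_norml => /andP[] *; lra.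
- by apply/funext => x /=; lra.
- by move=> c d cd; rewrite -VE//; congr _%:E; lra.
Qed.

End jordan_decomposition.

(** * Lebesgue-Stieltjes measure of half-open intervals and of points *)

Section lebesgue_stieltjes_values.
Context {R : realType}.
Implicit Type F : cumulative R R.

Lemma lebesgue_stieltjes_measure_itvoc F (c d : R) : c <= d ->
  lebesgue_stieltjes_measure F `]c, d]%classic = (F d - F c)%:E.
Proof.
move=> cd; rewrite /lebesgue_stieltjes_measure /measure_extension/=.
by rewrite measurable_mu_extE/= ?wlength_itv_bnd//; exact: is_ocitv.
Qed.

(** Continuity from above along the intervals []c - 1/(n+1), c]], which decrease to [[set c]]. *)
Lemma lebesgue_stieltjes_measure_set1 F (c l : R) :
  F y @[y --> c^'-] --> l ->
  lebesgue_stieltjes_measure F [set c] = (F c - l)%:E.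
Proof.
move=> Fl; pose u (n : nat) := c - n.+1%:R^-1.
have uc n : u n < c by rewrite /u ltrBlDr ltrDl.
have ucvg : u n @[n --> \oo] --> c.
  rewrite -[X in _ --> X]subr0; apply: cvgB; first exact: cvg_cst.
  exact: cvg_harmonic.
have Fu : F (u n) @[n --> \oo] --> l by move/cvg_at_leftP : Fl; apply.
have -> : [set c] = \bigcap_n (`]u n, c]%classic : set (measurableTypeR R)).
  apply/seteqP; split => [_ -> n _ /=|x xu].
    by rewrite in_itv/= uc lexx.
  apply/eqP; rewrite eq_le.
  have /= := xu 0%N Logic.I; rewrite in_itv/= => /andP[_ ->]/=.
  rewrite -(cvg_lim _ ucvg)//; apply: limr_le; first exact: cvgP ucvg.
  by apply: nearW => n; have /= := xu n Logic.I; rewrite in_itv/= => /andP[/ltW].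
have : lebesgue_stieltjes_measure F \o
    (fun n => `]u n, c]%classic : set (measurableTypeR R)) @ \oo -->
    lebesgue_stieltjes_measure F
      (\bigcap_n (`]u n, c]%classic : set (measurableTypeR R))).
  apply: nonincreasing_cvg_mu => //.
  - by rewrite /= lebesgue_stieltjes_measure_itvoc ?ltry// ltW.
  - by apply: bigcapT_measurable => n; exact: measurable_itv.
  - move=> m n mn; apply/subsetPset => x /=; rewrite !in_itv/= => /andP[ux ->].
    rewrite andbT (le_lt_trans _ ux)// /u lerD2l lerN2 lef_pV2 ?posrE//.
    by rewrite ler_nat ltnS.
move/cvg_lim => <- //; apply/cvg_lim => //.
rewrite (_ : _ \o _ = (fun n => (F c - F (u n))%:E)); last first.
  by apply/funext => n /=; rewrite lebesgue_stieltjes_measure_itvoc// ltW.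
by apply: cvg_EFin; [exact: nearW|apply: cvgB => //; exact: cvg_cst].
Qed.

End lebesgue_stieltjes_values.

(** * Locally finite signed measures *)

Section signed_measures.
Context {R : realType}.
Implicit Types (mu : set (measurableTypeR R) -> \bar R) (I : set R).

(** With [r] the finite value at [set0], additivity on a constantly empty family makes [r *+ n]
    converge; its consecutive differences all equal [r] and tend to 0. *)
Lemma semi_sigma_additive_set0 d (T : measurableType d)
    (mu : set T -> \bar R) :
  fin_num_fun mu -> semi_sigma_additive mu -> mu set0 = 0%E.
Proof.
move=> finmu /(_ (fun=> set0)) smu.
have {smu} : (fun n => \sum_(0 <= i < n) mu (@set0 T))%E @ \oo --> mu set0.
  have := smu (fun=> measurable0) (@trivIset_set0 _ _ _).
  by rewrite bigcup0//; apply.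
move: (finmu _ measurable0); case: (mu set0) => // r _ rcvg.
have {}rcvg : (r *+ n) @[n --> \oo] --> r.
  apply: cvg_trans (fine_cvg rcvg); apply: near_eq_cvg; apply: nearW => n /=.
  by rewrite sumEFin /= sumr_const_nat subn0.
have rScvg : (r *+ n.+1) @[n --> \oo] --> r by rewrite (cvg_shiftS (fun n => r *+ n)).
have : (r *+ n.+1 - r *+ n) @[n --> \oo] --> r - r by exact: cvgB.
under eq_fun do rewrite mulrSr addrAC subrr add0r.
by rewrite subrr => /cvg_lim; rewrite lim_cst// => ->.
Qed.

Lemma bounded_interval_measurable I : bounded_interval I ->
  measurable (I : set (measurableTypeR R)).
Proof. by case=> /is_intervalP -> _; exact: measurable_itv. Qed.

Lemma bounded_interval_sub_itvoc I : bounded_interval I ->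
  exists M, 0 <= M /\ I `<=` `]- M, M]%classic.
Proof.
move=> [_ [M [_ MI]]]; exists (`|M| + 1); split; first by rewrite addr_ge0.
(* [bounded_set] only offers bounds strictly above [M], whence the first 1/2; the other 1/2 keeps
   [I] off the open left endpoint. *)
have {}MI x : I x -> `|x| <= `|M| + 1/2.
  by apply: MI; rewrite (le_lt_trans (ler_norm _))// ltrDl.
by move=> x /MI /=; rewrite in_itv/= ler_norml => /andP[*]; apply/andP; lra.
Qed.

(** Makes the theory of charges available for [mu] on a bounded interval. *)
Lemma charge_of_signed_measure mu I :
  locally_finite_signed_measure mu -> bounded_interval I ->
  exists nu : {charge set (measurableTypeR R) -> \bar R},
    forall A, nu A = mu (A `&` I).
Proof.
move=> lfmu bI; have [finmu smu] := lfmu _ bI.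
pose muI (A : set (measurableTypeR R)) := mu (A `&` I).
pose isC := @isCharge.Build _ (measurableTypeR R) R muI
  (semi_sigma_additive_set0 finmu smu) finmu smu.
pose nu : {charge set (measurableTypeR R) -> \bar R} := HB.pack muI isC.
by exists nu.
Qed.

(** Half-open intervals are stable under intersection and generate the Borel sets, so Dynkin
    induction applies. The whole line is not one of them; its mass is what settles complements. *)
Lemma charge_ocitv_unique
    (nu1 nu2 : {charge set (measurableTypeR R) -> \bar R}) :
  nu1 setT = nu2 setT -> (forall X, ocitv X -> nu1 X = nu2 X) ->
  forall A, measurable A -> nu1 A = nu2 A.
Proof.
move=> nuT nuoc A mA.
apply: (@dynkin_induction _ (measurableTypeR R) (@ocitv R)
  [set A | nu1 A = nu2 A]) => //.
- exact: ocitvI.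
- by move=> S mS /= eqS; rewrite -setTD !chargeD// nuT !setTI eqS.
- move=> F mF tF eqF /=.
  have mUF : measurable (\bigcup_k F k) by exact: bigcup_measurable.
  have := @charge_semi_sigma_additive _ _ _ nu1 _ mF tF mUF.
  under eq_fun do under eq_bigr do rewrite eqF.
  have := @charge_semi_sigma_additive _ _ _ nu2 _ mF tF mUF.
  by move=> /cvg_lim <- // /cvg_lim <- //.
Qed.

(* Restricting to a half-open interval keeps the traces of the generating
half-open intervals in the generating family. *)
Lemma signed_measure_unique mu1 mu2 (a b : R) :
  locally_finite_signed_measure mu1 -> locally_finite_signed_measure mu2 ->
  (forall c d, c < d -> mu1 `]c, d]%classic = mu2 `]c, d]%classic) ->
  forall A, measurable A -> A `<=` `]a, b]%classic -> mu1 A = mu2 A.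
Proof.
move=> lf1 lf2 mu12 A mA Aab.
have bI : bounded_interval `]a, b]%classic.
  by apply: (@bounded_interval_itv _ _ a b); exact: subset_itv_oc_cc.
have [nu1 nu1E] := charge_of_signed_measure lf1 bI.
have [nu2 nu2E] := charge_of_signed_measure lf2 bI.
have nu12 X : ocitv X -> nu1 X = nu2 X.
  move=> oX; rewrite nu1E nu2E.
  have /ocitvP[XI|[[c d]/= cd XI]] := ocitvI oX (is_ocitv a b).
    by have := charge0 nu1; have := charge0 nu2;
      rewrite nu1E nu2E set0I XI => -> ->.
  by rewrite XI; exact: mu12.
suff : nu1 A = nu2 A by rewrite nu1E nu2E setIidl.
apply: charge_ocitv_unique => //.
(* The total mass of each restriction is its value on []a, b]], a generating interval. *)
by have := nu12 _ (is_ocitv a b); rewrite !nu1E !nu2E setTI setIid.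
Qed.

(** The other kinds of intervals differ from []c, d]] by endpoints, which are removed or added
    inside the charge induced on [[c, d]]. *)
Lemma is_measure_of_itvoc (f : R -> R) mu :
  locally_finite_signed_measure mu ->
  (forall c d, c < d ->
    mu `]c, d]%classic = (right_lim f d - right_lim f c)%:E) ->
  (forall c, mu [set c] = (right_lim f c - left_lim f c)%:E) ->
  is_measure_of f mu.
Proof.
move=> lf mu_oc mu1; split => // c d cd.
have bI : bounded_interval `[c, d]%classic.
  exact: (@bounded_interval_itv _ _ c d).
have [nu nuE] := charge_of_signed_measure lf bI.
have muE A : A `<=` `[c, d]%classic -> nu A = mu A.
  by move=> AI; rewrite nuE setIidl.
have sub1 x : x \in `[c, d] -> [set x] `<=` `[c, d]%classic.
  by move=> xcd _ ->.
have m1 x : measurable ([set x] : set (measurableTypeR R)).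
  exact: measurable_set1.
have mi (i : interval R) : measurable ([set` i] : set (measurableTypeR R)).
  exact: measurable_itv.
have oo : mu `]c, d[%classic = (left_lim f d - right_lim f c)%:E.
  rewrite -muE; last exact: subset_itv_oo_cc.
  have -> : `]c, d[%classic = `]c, d]%classic `\` [set d].
    by rewrite setDitv1r.
  rewrite chargeD// (_ : _ `&` _ = [set d]); last first.
    by apply/setIidr => _ ->; rewrite /= in_itv/= cd lexx.
  rewrite !muE ?mu_oc// ?mu1//; last 2 first.
    by apply: sub1; rewrite in_itv/= lexx ltW.
    exact: subset_itv_oc_cc.
  by rewrite -EFinB; congr _%:E; lra.
have co : mu `[c, d[%classic = (left_lim f d - left_lim f c)%:E.
  rewrite -muE; last exact: subset_itv_co_cc.
  have -> : `[c, d[%classic = [set c] `|` `]c, d[%classic.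
    by rewrite setU1itv.
  rewrite chargeU//; last first.
    by apply/seteqP; split => // x [-> /=]; rewrite in_itv/= ltxx.
  rewrite !muE ?oo ?mu1//; last 2 first.
    exact: subset_itv_oo_cc.
    by apply: sub1; rewrite in_itv/= lexx ltW.
  by rewrite -EFinD; congr _%:E; lra.
split => //; last exact: mu_oc.
rewrite -muE//.
have -> : `[c, d]%classic = [set c] `|` `]c, d]%classic.
  by rewrite setU1itv// bnd_simp ltW.
rewrite chargeU//; last first.
  by apply/seteqP; split => // x [-> /=]; rewrite in_itv/= ltxx.
rewrite !muE ?mu_oc ?mu1//; last 2 first.
  exact: subset_itv_oc_cc.
  by apply: sub1; rewrite in_itv/= lexx ltW.
by rewrite -EFinD; congr _%:E; lra.
Qed.

(** Both measures may be infinite on the line, but they are finite on a bounded interval, where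
    their restrictions subtract as charges. *)
Lemma locally_finite_lebesgue_stieltjesB (F G : cumulative R R) :
  locally_finite_signed_measure (fun A =>
    lebesgue_stieltjes_measure F A - lebesgue_stieltjes_measure G A)%E.
Proof.
move=> I bI; have mI := bounded_interval_measurable bI.
have [M [M0 IM]] := bounded_interval_sub_itvoc bI.
have finI (H : cumulative R R) : (lebesgue_stieltjes_measure H I < +oo)%E.
  apply: (@le_lt_trans _ _
      (lebesgue_stieltjes_measure H (`]- M, M]%classic : set (measurableTypeR R)))).
    by apply: le_measure; rewrite ?inE//; exact: measurable_itv.
  by rewrite lebesgue_stieltjes_measure_itvoc ?ltry//; lra.
pose nu := cadd (charge_of_finite_measure (mfrestr mI (finI F)))
  (copp (charge_of_finite_measure (mfrestr mI (finI G)))).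
rewrite (_ : (fun A => _ - _)%E = nu) //.
by split; [exact: fin_num_measure|exact: charge_semi_sigma_additive].
Qed.

End signed_measures.

(** * Upper bound for the pointwise variation *)

Section variation_upper_bound.
Context {R : realType}.
Local Open Scope ereal_scope.

(** Frees the index type, so that a family indexed by a sum type can compete in the supremum. *)
Lemma total_variation_measure_ge (mu : set (measurableTypeR R) -> \bar R)
    (E : set (measurableTypeR R)) (T : finType)
    (A : T -> set (measurableTypeR R)) :
  (forall i, measurable (A i)) -> (forall i, A i `<=` E) ->
  trivIset [set: T] A ->
  \sum_(i : T) `|mu (A i)| <= total_variation_measure mu E.
Proof.
move=> mA AE tA; apply: ereal_sup_ubound; exists #|T|, (A \o enum_val).
split => // [k|k|i j _ _ /= Aij|].
- exact: mA.
- exact: AE.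
- exact/enum_val_inj/tA.
- by rewrite big_enum_val.
Qed.

Lemma pV_le_total_variation_measure (f : R -> R)
    (mu : set (measurableTypeR R) -> \bar R) (E : set R) :
  is_interval E -> is_measure_of f mu ->
  pV f E <= total_variation_measure mu E + \esum_(x in E) (rho f x)%:E.
Proof.
move=> iE [_ mui mu1]; apply: ge_ereal_sup => _ [n [t [tE t_incr ->]]].
have lt_t i j : (i < j <= n)%N -> (t i < t j)%R.
  move=> /andP[]; elim: j => // j IHj; rewrite ltnS leq_eqVlt => /orP[/eqP->|ij] jn.
    exact: t_incr.
  by rewrite (lt_trans (IHj ij (ltnW jn)))// t_incr.
have le_t i j : (i <= j <= n)%N -> (t i <= t j)%R.
  rewrite leq_eqVlt => /andP[/orP[/eqP->//|ij] jn].
  by rewrite ltW// lt_t// ij.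
(* The [n] open gaps between successive nodes, and the [n.+1] nodes themselves. *)
pose A (k : 'I_n + 'I_n.+1) : set (measurableTypeR R) :=
  match k with inl i => `]t i, t i.+1[%classic | inr i => [set t i] end.
have mA k : measurable (A k).
  by case: k => i /=; [exact: measurable_itv|exact: measurable_set1].
have AE k : A k `<=` E.
  case: k => i /= x.
    rewrite /= in_itv/= => /andP[tx xt].
    apply: (iE (t i) (t i.+1)); [exact/tE/ltnW|exact: tE|].
    by rewrite !ltW.
  by move=> ->; apply: tE; rewrite -ltnS.
have lt_inv i j : (i <= n)%N -> (t i < t j)%R -> (i < j)%N.
  move=> i_n; rewrite !ltNge => tij; rewrite ltnNge; apply: contra tij => ji.
  by rewrite le_t// ji.
have tA : trivIset [set: 'I_n + 'I_n.+1] A.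
  move=> [i|i] [j|j] _ _ [y []] /=; rewrite ?in_itv/=.
  - move=> /andP[iy yi] /andP[jy yj]; congr inl; apply/val_inj/eqP => /=.
    have ij := lt_inv _ _ (ltnW (ltn_ord i)) (lt_trans iy yj).
    have ji := lt_inv _ _ (ltnW (ltn_ord j)) (lt_trans jy yi).
    by rewrite eqn_leq -ltnS ij -ltnS ji.
  - move=> /andP[iy yi] yj; rewrite {}yj in iy yi.
    have ij := lt_inv _ _ (ltnW (ltn_ord i)) iy.
    have jn : (j <= n)%N by rewrite -ltnS.
    by have := lt_inv _ _ jn yi; rewrite ltnS leqNgt ij.
  - move=> yi /andP[jy yj]; rewrite {}yi in jy yj.
    have ji := lt_inv _ _ (ltnW (ltn_ord j)) jy.
    have i_n : (i <= n)%N by rewrite -ltnS.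
    by have := lt_inv _ _ i_n yj; rewrite ltnS leqNgt ji.
  - move=> -> tij; congr inr; apply/val_inj/eqP => /=.
    have [ij|ji|//] := ltngtP i j.
      by have := lt_t i j; rewrite ij -ltnS ltn_ord tij ltxx => /(_ isT).
    by have := lt_t j i; rewrite ji -ltnS ltn_ord tij ltxx => /(_ isT).
have rho_le : \sum_(0 <= i < n.+1) (rho f (t i))%:E <=
    \esum_(x in E) (rho f x)%:E.
  have ut : uniq (map t (index_iota 0 n.+1)).
    rewrite map_inj_in_uniq ?iota_uniq// => i j.
    rewrite !mem_index_iota !ltnS => /= i_n jn tij.
    have [ij|ji|//] := ltngtP i j.
      by have := lt_t i j; rewrite ij jn tij ltxx => /(_ isT).
    by have := lt_t j i; rewrite ji i_n tij ltxx => /(_ isT).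
  apply: esum_ge; exists [set` map t (index_iota 0 n.+1)].
    split; first exact: finite_seq.
    move=> x xs; have /mapP[i + ->] : x \in map t (index_iota 0 n.+1) by exact: xs.
    by rewrite mem_index_iota ltnS => /tE.
  by rewrite -fsbig_seq// big_map.
apply: le_trans (leeD (total_variation_measure_ge mu mA AE tA) rho_le).
rewrite big_sumType/= [X in _ <= X + _ + _](_ : _ =
    \sum_(i < n) `|left_lim f (t i.+1) - right_lim f (t i)|%:E); last first.
  by apply: eq_bigr => i _; have [-> //] := mui _ _ (t_incr i (ltn_ord i)).
rewrite [X in _ <= _ + X + _](_ : _ =
    \sum_(i < n.+1) `|right_lim f (t i) - left_lim f (t i)|%:E); last first.
  by apply: eq_bigr => i _; rewrite mu1.
rewrite -addeA big_mkord (big_mkord _ (fun i => (rho f (t i))%:E)).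
rewrite -big_split/= !sumEFin lee_fin.
rewrite [X in (_ <= _ + X)%R](eq_bigr (fun i : 'I_n.+1 =>
    `|right_lim f (t i) - f (t i)| + `|f (t i) - left_lim f (t i)|)%R); last first.
  by move=> i _; rewrite /rho addrC subrK.
(* The right jump at [t n] and the left jump at [t 0] belong to no increment; they are split off
   here and discarded at the end. *)
rewrite big_split/= big_ord_recr big_ord_recl/=.
set a := (\sum_(i < n) `|right_lim f (t i) - f (t i)|)%R.
apply: (@le_trans _ _ (\sum_(i < n) (`|left_lim f (t i.+1) - right_lim f (t i)| +
    (`|right_lim f (t i) - f (t i)| +
     `|f (t i.+1) - left_lim f (t i.+1)|)))%R).
  apply: ler_sum => i _.
  have -> : (f (t i.+1) - f (t i) = (left_lim f (t i.+1) - right_lim f (t i)) +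
      ((right_lim f (t i) - f (t i)) + (f (t i.+1) - left_lim f (t i.+1))))%R.
    by lra.
  by rewrite (le_trans (ler_normD _ _))// lerD2l ler_normD.
rewrite !big_split/= -/a /bump/=.
rewrite lerD2l; apply: lerD; first by rewrite lerDl.
exact: ler_wpDl.
Qed.

End variation_upper_bound.

(** * The signed measure of a difference of monotone functions, and its domination *)

Definition right_cumulative (R : realType) (g : R -> R)
    (ndg : {homo g : x y / x <= y}) : cumulative R R :=
  HB.pack (right_lim g) (isCumulative.Build R _ R (right_lim g)
    (nondecreasing_right_lim ndg) (right_continuous_right_lim ndg)).

Section jordan_measures.
Context {R : realType} (f g h : R -> R).
Hypotheses (ndg : {homo g : x y / x <= y}) (ndh : {homo h : x y / x <= y}).
Hypothesis fE : f = g \- h.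
Implicit Types A B : set (measurableTypeR R).
Local Open Scope ereal_scope.

Let G := lebesgue_stieltjes_measure (right_cumulative ndg).
Let H := lebesgue_stieltjes_measure (right_cumulative ndh).

Lemma right_limB x : right_lim f x = (right_lim g x - right_lim h x)%R.
Proof.
apply/cvg_lim => //; rewrite fE.
by apply: cvgB; exact: nondecreasing_cvg_right_lim.
Qed.

Lemma left_limB x : left_lim f x = (left_lim g x - left_lim h x)%R.
Proof.
apply/cvg_lim => //; rewrite fE.
by apply: cvgB; exact: nondecreasing_cvg_left_lim.
Qed.

Lemma right_cumulative_set1 k (ndk : {homo k : x y / (x <= y)%R}) (x : R) :
  lebesgue_stieltjes_measure (right_cumulative ndk) [set x] =
  (right_lim k x - left_lim k x)%:E.
Proof. exact/lebesgue_stieltjes_measure_set1/cvg_right_lim_at_left. Qed.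

Lemma right_cumulative_itvoo k (ndk : {homo k : x y / (x <= y)%R}) (c d : R) :
  (c < d)%R -> lebesgue_stieltjes_measure (right_cumulative ndk) `]c, d[%classic =
  (left_lim k d - right_lim k c)%:E.
Proof.
move=> cd; have -> : `]c, d[%classic = `]c, d]%classic `\` [set d].
  by rewrite setDitv1r.
rewrite measureD//=; last first.
  by rewrite lebesgue_stieltjes_measure_itvoc ?ltry// ltW.
rewrite (_ : _ `&` _ = [set d]); last first.
  by apply/setIidr => _ ->; rewrite /= in_itv/= cd lexx.
rewrite lebesgue_stieltjes_measure_itvoc ?right_cumulative_set1 1?ltW//=.
by rewrite -EFinB; congr _%:E; lra.
Qed.

Lemma is_measure_of_jordan : is_measure_of f (fun A => G A - H A).
Proof.
apply: is_measure_of_itvoc => [|c d cd|c].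
- exact: locally_finite_lebesgue_stieltjesB.
- rewrite /G /H !lebesgue_stieltjes_measure_itvoc ?ltW//= !right_limB -EFinB.
  by congr _%:E; lra.
- rewrite /G /H !right_cumulative_set1 right_limB left_limB -EFinB.
  by congr _%:E; lra.
Qed.

(** The Jordan difference is a witness, which rules out the default value of [xget]. *)
Lemma signed_measure_ofP : is_measure_of f (signed_measure_of f).
Proof. by apply: xgetPex; eexists; exact: is_measure_of_jordan. Qed.

Variables (a b : R).
Let mu := signed_measure_of f.
Let nu := measure_add G H.

Lemma signed_measure_ofE A : measurable A -> A `<=` `]a, b]%classic ->
  mu A = G A - H A.
Proof.
have [lf1 oc1 _] := signed_measure_ofP.
have [lf2 oc2 _] := is_measure_of_jordan.
apply: (signed_measure_unique lf1 lf2) => c d cd.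
have [_ _ _ ->] := oc1 _ _ cd.
by have [_ _ _ ->] := oc2 _ _ cd.
Qed.

Lemma abs_signed_measure_of_le A : measurable A -> A `<=` `]a, b]%classic ->
  `|mu A| <= nu A.
Proof.
move=> mA Aab; rewrite signed_measure_ofE// /nu measure_addE.
by rewrite (le_trans (lee_abs_sub _ _))// !gee0_abs.
Qed.

(** The left side is the sum of the absolute one-sided jumps of [f] at [x]; each is at most the
    corresponding jump of [g] plus that of [h]. *)
Lemma signed_measure_of_set1_rho_le (x : R) :
  `|mu [set x]| + (rho f x)%:E <= nu [set x].
Proof.
have [_ _ mu1] := signed_measure_ofP.
rewrite /mu mu1 /nu measure_addE /G /H/= !right_cumulative_set1 -!EFinD lee_fin.
rewrite /rho addrC subrK right_limB left_limB fE/=.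
have := right_lim_ge ndg x; have := right_lim_ge ndh x.
have := left_lim_le ndg x; have := left_lim_le ndh x.
move=> hl gl hr gr.
rewrite (_ : (_ + (_ - _))%R = (right_lim g x - g x + (right_lim h x - h x)) +
  (g x - left_lim g x + (h x - left_lim h x)))%R; last lra.
by apply: lerD; rewrite ler_norml; apply/andP; split; lra.
Qed.

Lemma rho_ge0 x : (0 <= rho f x)%R.
Proof.
rewrite /rho subr_ge0 (le_trans _ (ler_normD _ _))//.
by rewrite subrKA.
Qed.

Lemma signed_measure_of_subadditive A B : measurable A -> measurable B ->
  A `<=` `]a, b]%classic -> B `<=` `]a, b]%classic ->
  A `&` B = set0 -> `|mu (A `|` B)| <= `|mu A| + `|mu B|.
Proof.
move=> mA mB Aab Bab AB0.
have bI : bounded_interval `]a, b]%classic.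
  by apply: (@bounded_interval_itv _ _ a b); exact: subset_itv_oc_cc.
have [lf _ _] := signed_measure_ofP.
have [k kE] := charge_of_signed_measure lf bI.
have muE C : C `<=` `]a, b]%classic -> mu C = k C by move=> Cab; rewrite kE setIidl.
rewrite !muE//; last by rewrite subUset.
by rewrite chargeU// lee_abs_add.
Qed.

(** Induction on [X]: a point lying in [A] is cut out of [A] and paid for by its own atom of
    [nu]. *)
Lemma signed_measure_of_rho_le (X : seq R) A : uniq X -> measurable A ->
  A `<=` `]a, b]%classic ->
  `|mu A| + \sum_(x <- X | x \in A) (rho f x)%:E <= nu A.
Proof.
elim: X A => [A _ mA Aab|x X IHX A /= /andP[xX uX] mA Aab].
  by rewrite big_nil adde0 abs_signed_measure_of_le.
rewrite big_cons; case: ifPn => [|_]; last exact: IHX.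
rewrite inE => Ax.
have m1 : measurable ([set x] : set (measurableTypeR R)).
  exact: measurable_set1.
have mAx : measurable (A `\` [set x]) by exact: measurableD.
have Axab : A `\` [set x] `<=` `]a, b]%classic.
  exact: subset_trans Aab.
have := IHX _ uX mAx Axab.
(* Removing [x] from [A] leaves the sum over the tail unchanged, since [x] does not occur there. *)
rewrite [X in _ + X <= _ -> _](_ : _ = \sum_(y <- X | y \in A) (rho f y)%:E).
  move=> le_Ax.
  have AE : A = [set x] `|` (A `\` [set x]).
    by rewrite setDUK// => _ ->.
  have nuA : nu A = nu [set x] + nu (A `\` [set x]).
    rewrite [in LHS]AE; apply: (@measureU _ _ _ nu) => //.
    by rewrite setDIK.
  rewrite nuA.
  apply: le_trans (leeD (signed_measure_of_set1_rho_le x) le_Ax).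
  rewrite addeACA; apply: leeD => //; rewrite [in leLHS]AE.
  apply: signed_measure_of_subadditive => //; last by rewrite setDIK.
  by move=> _ ->; exact: Aab.
rewrite big_seq_cond [RHS]big_seq_cond; apply: eq_bigl => y.
case yX : (y \in X) => //=; apply/idP/idP; rewrite !inE; first by case.
by move=> Ay; split => // yx; move: xX; rewrite -yx yX.
Qed.

(** Points of [X] may avoid every [A k], so the remainder of the interval serves as one more piece;
    the previous bound is summed over all pieces. *)
Lemma total_variation_rho_le m (A : 'I_m -> set (measurableTypeR R))
    (X : seq R) :
  (forall k, measurable (A k)) -> (forall k, A k `<=` `]a, b[%classic) ->
  trivIset setT A -> uniq X -> {subset X <= `]a, b[} ->
  \sum_(k < m) `|mu (A k)| + \sum_(x <- X) (rho f x)%:E <=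
  nu (`]a, b[%classic : set (measurableTypeR R)).
Proof.
move=> mA Aab tA uX Xab.
pose E : set (measurableTypeR R) := `]a, b[%classic.
pose U := \big[setU/set0]_(k < m) A k.
have mU : measurable U by exact: bigsetU_measurable.
have mE : measurable E by exact: measurable_itv.
have mD : measurable (E `\` U) by exact: measurableD.
have subE B : B `<=` E -> B `<=` `]a, b]%classic.
  by move/subset_trans; apply; exact: subset_itv_oo_oc.
have EU : E `&` U = U.
  by apply/setIidr; rewrite /U -bigcup_seq; exact: bigcup_sub.
have -> : nu E = \sum_(k < m) nu (A k) + nu (E `\` U).
  transitivity (nu (E `\` U) + nu (E `&` U)); first exact: measureDI.
  by rewrite EU addeC; congr (_ + _); exact: measure_semi_additive_ord.
have le_D := signed_measure_of_rho_le uX mD (subE _ (@subDsetl _ _ _)).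
have le_A k := signed_measure_of_rho_le uX (mA k) (subE _ (Aab k)).
apply: le_trans (leeD (lee_sum _ (fun k _ => le_A k)) le_D).
rewrite big_split/= -addeA leeD2l//.
rewrite (eq_bigr (fun k => \sum_(x <- X) if x \in A k then (rho f x)%:E else 0));
  last by move=> k _; rewrite big_mkcond.
rewrite exchange_big/= [X in _ <= _ + (_ + X)]big_mkcond/= addeCA.
rewrite (le_trans _ (leeDr _ (abse_ge0 _)))//.
rewrite -big_split/= big_seq [leRHS]big_seq; apply: lee_sum => x /Xab xab.
have s0 (k : 'I_m) : true -> 0 <= (if x \in A k then (rho f x)%:E else 0).
  by case: ifP => // _ _; rewrite lee_fin rho_ge0.
(* The point [x] lies either in the remainder or in some [A k], and the term of that piece already
   covers [rho f x]. *)
case: ifPn => [_|]; first by apply: leeDr; exact: sume_ge0.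
rewrite notin_setE => /not_andP[/(_ xab)//|/contrapT].
rewrite /U -bigcup_seq => -[k _ Akx].
rewrite adde0 (bigD1 k)//= mem_set// leeDl//.
by apply: sume_ge0 => i _; exact: s0.
Qed.

End jordan_measures.

(** * Exhaustion of the open interval, and the equality *)

Lemma jordan_increments_le (R : realType) (g h : R -> R) (a b p : R) :
  {homo g : x y / x <= y} -> {homo h : x y / x <= y} -> a < b ->
  (forall c d, a < c -> c <= d -> d < b -> g d - g c + (h d - h c) <= p) ->
  left_lim g b - right_lim g a + (left_lim h b - right_lim h a) <= p.
Proof.
move=> ndg ndh ab le_p.
rewrite addrACA -opprD lerBlDr -lerBlDl.
(* Two successive limits: [c] tends to [a] from the right and, for each such fixed [c], [d] tends to
   [b] from the left. *)
apply: (@cvgr_to_ge _ (a^'+) _ _ (fun c => g c + h c)).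
  by apply: cvgD; exact: nondecreasing_cvg_right_lim.
near=> c; have ac : a < c by [].
rewrite lerBlDl -lerBlDr.
have cb : c < b by near: c; exact: nbhs_right_lt.
rewrite lerBlDr.
apply: (@cvgr_to_le _ (b^'-) _ _ (fun d => g d + h d)).
  by apply: cvgD; exact: nondecreasing_cvg_left_lim.
near=> d; have db : d < b by [].
have cd : c <= d by near: d; exact: nbhs_left_ge.
by have := le_p _ _ ac cd db; lra.
Unshelve. all: by end_near. Qed.

Theorem proposition3p1 (R : realType) (f : R -> R)
    (hf : locally_bounded_variation f) (a b : R) (hab : a < b) :
  pV f `]a, b[%classic =
  (total_variation_measure (signed_measure_of f) `]a, b[%classic
   + \esum_(x in `]a, b[%classic) (rho f x)%:E)%E.
Proof.
have [g [h [ndg ndh fE ghE]]] := jordan_decomposition hf.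
have muP := signed_measure_ofP ndg ndh fE.
have le_pV : (pV f `]a, b[%classic <= total_variation_measure
    (signed_measure_of f) `]a, b[%classic
    + \esum_(x in `]a, b[%classic) (rho f x)%:E)%E.
  by apply: pV_le_total_variation_measure muP; exact: interval_is_interval.
apply/eqP; rewrite eq_le le_pV/=.
have ab2 : `]a, b[%classic ((a + b) / 2) by rewrite /= in_itv/= !midf_lt.
have pV0 : (0 <= pV f `]a, b[%classic)%E := pV_ge0 f ab2.
have pVfin : pV f `]a, b[%classic \is a fin_num.
  rewrite ge0_fin_numE//; apply: hf.
  by apply: (@bounded_interval_itv _ _ a b); exact: subset_itv_oo_cc.
set TV := total_variation_measure _ _.
(* The two suprema are handled in turn: over the families [A] with [X] fixed, then over the finite
   sets of points. Finiteness of [pV] and [TV] justifies moving terms across the inequality. *)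
have TV_le (X : seq R) : uniq X -> {subset X <= `]a, b[} ->
    (TV <= pV f `]a, b[%classic - \sum_(x <- X) (rho f x)%:E)%E.
  move=> uX Xab; apply: ge_ereal_sup => _ [m [A [mA Aab tA ->]]].
  rewrite leeBrDr; last by rewrite sumEFin.
  apply: le_trans (total_variation_rho_le ndg ndh fE mA Aab tA uX Xab) _.
  rewrite measure_addE/= !right_cumulative_itvoo// -EFinD -(fineK pVfin) lee_fin.
  apply: jordan_increments_le => // c d ac cd db.
  rewrite -lee_fin fineK// ghE//; apply: total_variation_le_pV => //.
  by apply: subset_itv; rewrite bnd_simp.
have TV0 : (0 <= TV)%E.
  apply: ereal_sup_ubound; exists 0%N, (fun=> set0).
  by split=> [[]|[]|[]|]; rewrite ?big_ord0.
have TVfin : TV \is a fin_num.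
  rewrite ge0_fin_numE// (@le_lt_trans _ _ (pV f `]a, b[%classic))//.
    (* With no points at all, [TV_le] bounds [TV] by [pV]. *)
    by have := TV_le [::]; rewrite big_nil sube0; apply.
  by rewrite ltey_eq pVfin.
rewrite addeC -leeBrDr//; apply: ge_ereal_sup => _ [X [finX Xab] <-].
rewrite leeBrDl// fsbig_finite//= -leeBrDr; last by rewrite sumEFin.
apply: TV_le => [|x]; first exact: finmap.fset_uniq.
by rewrite in_fset_set// inE => /Xab.
Qed.
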